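(* Let $\hat n\in\mathbb{R}^3$ be a unit vector, let $\alpha\in\mathbb{R}$, and let $\mathcal{R}(\hat n,\alpha)\in SO(3)$ be the rotation about the axis $\hat n$ by the angle $\alpha$. Then there is a matrix $\mathcal{U}(\hat n,\alpha)\in SU(2)$, depending only on $(\hat n,\alpha)$, such that for every $\vec r\in\mathbb{R}^3$ with $\|\vec r\|\le 1$, setting $\vec r\,'=\mathcal{R}(\hat n,\alpha)\vec r$, one has $$\rho_{\vec r\,'}=\mathcal{U}(\hat n,\alpha)\,\rho_{\vec r}\,\mathcal{U}(\hat n,\alpha)^*.$$
   Context: For $\vec r=(x_1,x_2,x_3)\in\mathbb{R}^3$ with $\|\vec r\|\le 1$, the associated qubit state (density operator on $\mathbb{C}^2$) is $\rho_{\vec r}=\frac12(\mathbb{I}+\vec r\cdot\vec\sigma)$, where $\vec r\cdot\vec\sigma=\sum_{j=1}^3 x_j\sigma_j$ and $\sigma_1,\sigma_2,\sigma_3$ are the Pauli matrices. The rotation $\mathcal{R}(\hat n,\alpha)$ is given by Rodrigues's formula $\mathcal{R}_{jk}(\hat n,\alpha)=\delta_{jk}\cos\alpha+n_jn_k(1-\cos\alpha)-\sum_{l=1}^3\varepsilon_{jkl}n_l\sin\alpha$, with $\varepsilon_{jkl}$ the Levi-Civita symbol. The symbol $^*$ denotes the conjugate transpose (adjoint). *)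

(* Defs.v *)
From mathcomp Require Import all_boot all_order all_algebra.
From mathcomp Require Export spectral sesquilinear.
From mathcomp Require Import reals trigo.
From mathcomp Require Import complex ring.

Set Implicit Arguments.
Unset Strict Implicit.
Unset Printing Implicit Defensive.

Import Order.TTheory GRing.Theory Num.Theory.
Local Open Scope ring_scope.
Local Open Scope complex_scope.

(* The norm that MathComp-Analysis puts on matrices is the sup norm; the
   Euclidean norm has to be defined separately. *)
Definition enorm (R : realType) (n : nat) (v : 'cV[R]_n) : R :=
  Num.sqrt (\sum_i v i 0 ^+ 2).

Definition is_SO (R : realType) (n : nat) (A : 'M[R]_n) : Prop :=
  A *m A^T = 1%:M /\ \det A = 1.

Definition is_SU (R : realType) (n : nat) (U : 'M[R[i]]_n) : Prop :=
  U \is unitarymx /\ \det U = 1.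

(* The indices 1, 2, 3 of the mathematical notation are 0, 1, 2 : 'I_3. *)
Definition levi_civita (R : realType) (j k l : 'I_3) : R :=
  match nat_of_ord j, nat_of_ord k, nat_of_ord l with
  | 0, 1, 2 | 1, 2, 0 | 2, 0, 1 => 1%R
  | 0, 2, 1 | 2, 1, 0 | 1, 0, 2 => (-1)%R
  | _, _, _ => 0%R
  end%N.

Definition rotation (R : realType) (n : 'cV[R]_3) (alpha : R) : 'M[R]_3 :=
  \matrix_(j, k) ((j == k)%:R * cos alpha
                  + n j 0 * n k 0 * (1 - cos alpha)
                  - \sum_l levi_civita R j k l * n l 0 * sin alpha).

Definition mx_of_rows (T : nzRingType) (m n : nat) (rows : seq (seq T)) :
    'M[T]_(m, n) :=
  \matrix_(a, b) nth 0 (nth [::] rows a) b.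

Definition pauli (R : realType) (j : 'I_3) : 'M[R[i]]_2 :=
  match nat_of_ord j with
  | 0 => (mx_of_rows 2 2 [:: [:: 0; 1]; [:: 1; 0]])%R
  | 1 => (mx_of_rows 2 2 [:: [:: 0; - 'i%C]; [:: 'i%C; 0]])%R
  | _ => (mx_of_rows 2 2 [:: [:: 1; 0]; [:: 0; -1]])%R
  end%N.

(* This is a density operator exactly when enorm r <= 1. *)
Definition qubit_state (R : realType) (r : 'cV[R]_3) : 'M[R[i]]_2 :=
  2^-1 *: (1%:M + \sum_j (r j 0)%:C *: pauli R j).

(* Well-definedness: Rodrigues's matrix is a rotation, and it maps the closed
   unit ball into itself. *)

Lemma rotation_SO (R : realType) (n : 'cV[R]_3) (alpha : R) :
  enorm n = 1 -> is_SO (rotation n alpha).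
Proof.
move=> n1.
have N : n 2%:R 0 ^+ 2 = 1 - n 0 0 ^+ 2 - n 1 0 ^+ 2.
  have s0 : 0 <= \sum_i n i 0 ^+ 2 by apply: sumr_ge0 => i _; exact: sqr_ge0.
  have := sqr_sqrtr s0; rewrite -/(enorm n) n1 expr1n => ->.
  have e1 : lift ord0 ord0 = 1 :> 'I_3 by apply: val_inj.
  have e2 : lift ord0 (lift ord0 ord0) = 2%:R :> 'I_3 by apply: val_inj.
  by rewrite !big_ord_recl big_ord0 ?e1 ?e2 /=; ring.
have S : sin alpha ^+ 2 = 1 - cos alpha ^+ 2 by rewrite sin2cos2.
have e1 : lift ord0 ord0 = 1 :> 'I_3 by apply: val_inj.
have e2 : lift ord0 (lift ord0 ord0) = 2%:R :> 'I_3 by apply: val_inj.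
pose c := cos alpha; pose s := sin alpha.
pose x := n 0 0; pose y := n 1 0; pose z := n 2%:R 0.
pose M := mx_of_rows 3 3
  [:: [:: c + x * x * (1 - c); x * y * (1 - c) - z * s; x * z * (1 - c) + y * s];
      [:: y * x * (1 - c) + z * s; c + y * y * (1 - c); y * z * (1 - c) - x * s];
      [:: z * x * (1 - c) - y * s; z * y * (1 - c) + x * s; c + z * z * (1 - c)]].
have -> : rotation n alpha = M.
  apply/matrixP => j k; rewrite !mxE !big_ord_recl big_ord0 e1 e2.
  have I3 (i : 'I_3) : [\/ i = 0, i = 1 | i = 2%:R].
    by case: i => [[|[|[|//]]] p]; [apply: Or31|apply: Or32|apply: Or33];
      apply: val_inj.
  by case: (I3 j) => ->; case: (I3 k) => ->;
    rewrite /levi_civita /= /x /y /z /c /s; ring.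
have {}N : z ^+ 2 = 1 - x ^+ 2 - y ^+ 2 by [].
have {}S : s ^+ 2 = 1 - c ^+ 2 by [].
split; last first.
  rewrite (expand_det_row _ ord0) !big_ord_recl big_ord0 /cofactor.
  rewrite !(expand_det_row _ ord0) !big_ord_recl !big_ord0 /cofactor.
  rewrite !det_mx11 !mxE /=.
  by ring: N S.
apply/matrixP => -[[|[|[|//]]] p] -[[|[|[|//]]] q];
  by rewrite !mxE !big_ord_recl big_ord0 !mxE /=; ring: N S.
Qed.

Lemma rotation_enorm (R : realType) (n r : 'cV[R]_3) (alpha : R) :
  enorm n = 1 -> enorm (rotation n alpha *m r) = enorm r.
Proof.
move=> /(@rotation_SO _ _ alpha)[/mulmx1C RtR _].
have enormE (v : 'cV[R]_3) : enorm v = Num.sqrt ((v^T *m v) 0 0).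
  by congr Num.sqrt; rewrite mxE; apply: eq_bigr => i _; rewrite mxE expr2.
by rewrite !enormE trmx_mul mulmxA -(mulmxA r^T) RtR mulmx1.
Qed.

(* Main.v *)
Require Import Defs.
From mathcomp Require Import all_boot all_order all_algebra.
From mathcomp Require Import reals trigo complex.
From mathcomp Require Import ring.
Import GRing.Theory Num.Theory.
Local Open Scope ring_scope.
Local Open Scope sesquilinear_scope.
Local Open Scope complex_scope.

(** The unitary is U = cos(alpha/2) I - i sin(alpha/2) (n . sigma).  Writing
    cos alpha and sin alpha in terms of the half angle, the claim becomes, entry
    by entry, a polynomial identity modulo |n|^2 = 1 and cos^2 + sin^2 = 1. *)

Definition pauli_vector (R : realType) (v : 'cV[R]_3) : 'M[R[i]]_2 :=
  \sum_j (v j 0)%:C *: pauli R j.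

(** For unit [n] this is the exponential of -i (alpha/2) (n . sigma), because (n . sigma)^2 = I. *)
Definition spin_rotation (R : realType) (n : 'cV[R]_3) (alpha : R) : 'M[R[i]]_2 :=
  (cos (alpha / 2))%:C *: 1%:M - ('i * (sin (alpha / 2))%:C) *: pauli_vector R n.

Lemma lift_ord3E : (lift ord0 ord0 = 1 :> 'I_3) *
  (lift ord0 (lift ord0 ord0) = 2%:R :> 'I_3).
Proof. by split; apply: val_inj. Qed.

(** Entries are given by real and imaginary part, so that a matrix identity splits into real
    polynomial identities within reach of [ring]. *)
Lemma pauli_vectorE (R : realType) (v : 'cV[R]_3) :
  pauli_vector R v = mx_of_rows 2 2
    [:: [:: v 2%:R 0 +i* 0; v 0 0 -i* v 1 0];
        [:: v 0 0 +i* v 1 0; - v 2%:R 0 +i* 0]].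
Proof.
rewrite /pauli_vector !big_ord_recl big_ord0 !lift_ord3E.
apply/matrixP => -[[|[|//]] p] -[[|[|//]] q]; rewrite !mxE /=;
  by apply/eqP; rewrite eq_complex /=; apply/andP; split; apply/eqP; ring.
Qed.

(** Cayley-Klein form: the rows are (a, -conj b) and (b, conj a), with a = c - i s n_3 and b = s n_2
    - i s n_1. *)
Lemma spin_rotationE (R : realType) (n : 'cV[R]_3) (alpha : R)
    (c := cos (alpha / 2)) (s := sin (alpha / 2)) :
  spin_rotation R n alpha = mx_of_rows 2 2
    [:: [:: c -i* (s * n 2%:R 0); - (s * n 1 0) -i* (s * n 0 0)];
        [:: s * n 1 0 -i* (s * n 0 0); c +i* (s * n 2%:R 0)]].
Proof.
rewrite /spin_rotation pauli_vectorE -/c -/s.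
apply/matrixP => -[[|[|//]] p] -[[|[|//]] q]; rewrite !mxE /=;
  by apply/eqP; rewrite eq_complex /=; apply/andP; split; apply/eqP; ring.
Qed.

(** Solving for one square makes the left side a monomial, as [ring: N S] needs in order to reduce
    modulo |n|^2 = 1. *)
Lemma enorm1_sqr (R : realType) (n : 'cV[R]_3) :
  enorm n = 1 -> n 2%:R 0 ^+ 2 = 1 - n 0 0 ^+ 2 - n 1 0 ^+ 2.
Proof.
move=> n1.
have s0 : 0 <= \sum_i n i 0 ^+ 2 by apply: sumr_ge0 => i _; exact: sqr_ge0.
have := sqr_sqrtr s0; rewrite -/(enorm n) n1 expr1n => ->.
by rewrite !big_ord_recl big_ord0 !lift_ord3E; ring.
Qed.

Lemma spin_rotation_SU (R : realType) (n : 'cV[R]_3) (alpha : R) :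
  enorm n = 1 -> is_SU (spin_rotation R n alpha).
Proof.
move=> /enorm1_sqr N; rewrite spin_rotationE.
have S := sin2cos2 (alpha / 2).
split; last first.
  (* The determinant is |a|^2 + |b|^2 = c^2 + s^2 |n|^2 = 1. *)
  rewrite (expand_det_row _ ord0) !big_ord_recl big_ord0 /cofactor !det_mx11 !mxE /=.
  by apply/eqP; rewrite eq_complex /=; apply/andP; split; apply/eqP; ring: N S.
apply/unitarymxP; apply/matrixP => -[[|[|//]] p] -[[|[|//]] q];
  rewrite !mxE !big_ord_recl big_ord0 !mxE /=;
  by apply/eqP; rewrite eq_complex /=; apply/andP; split; apply/eqP; ring: N S.
Qed.

(* Equivariance of v |-> v . sigma, i.e. the double cover SU(2) -> SO(3). *)
Lemma pauli_vector_rotation (R : realType) (n v : 'cV[R]_3) (alpha : R)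
    (U := spin_rotation R n alpha) :
  enorm n = 1 ->
  pauli_vector R (rotation n alpha *m v) = U *m pauli_vector R v *m U^t*.
Proof.
move=> /enorm1_sqr N; rewrite {}/U spin_rotationE !pauli_vectorE.
have S := sin2cos2 (alpha / 2).
(* The double-angle formulas bring the entries of [rotation] to the half angle used by U. *)
have aE : alpha = alpha / 2 *+ 2 by rewrite -mulr_natr; field.
have C2 : cos alpha = cos (alpha / 2) ^+ 2 *+ 2 - 1.
  by rewrite {1}aE cos_mulr2n.
have S2 : sin alpha = (cos (alpha / 2) * sin (alpha / 2)) *+ 2.
  by rewrite {1}aE sin_mulr2n.
apply/matrixP => -[[|[|//]] p] -[[|[|//]] q];
  rewrite !(mxE, big_ord_recl, big_ord0) !lift_ord3E /levi_civita /= C2 S2;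
  by apply/eqP; rewrite eq_complex /=; apply/andP; split; apply/eqP; ring: N S.
Qed.

Theorem mainTheorem1 (R : realType) (n : 'cV[R]_3) (alpha : R) :
  enorm n = 1 ->
  exists U : 'M[R[i]]_2,
    is_SU U /\
    forall r : 'cV[R]_3, enorm r <= 1 ->
      qubit_state (rotation n alpha *m r) = U *m qubit_state r *m U^t*.
Proof.
move=> n1; exists (spin_rotation R n alpha).
have [UU' detU] := spin_rotation_SU R n alpha n1; split=> // r _.
rewrite /qubit_state -!/(pauli_vector R _) pauli_vector_rotation //.
(* The Bloch part is settled by equivariance; the identity part is fixed by conjugation because U
   U^* = I. *)
move: (spin_rotation R n alpha) UU' {detU} => U /unitarymxP UU'.
by rewrite -scalemxAr -scalemxAl mulmxDr mulmxDl mulmx1 UU'.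
Qed.
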